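(* For every nonnegative integer $k\ne 1$, the set $\mathscr{D}\cap[0,k]$ is a well-ordered subset of $\mathbb{R}$ of order type $\omega^k$, while $\mathscr{D}\cap[0,1]$ has order type $\omega+1$.
   Context: $\|n\|$ is the complexity of a positive integer $n$: the least number of $1$'s needed to write $n$ using $1$, $+$, $\times$ and parentheses; $\delta(n)=\|n\|-3\log_3 n$ is its defect; $\mathscr{D}=\{\delta(n):n\ge1\}$ is the defect set. *)

(* Defs.v *)
From Stdlib Require Import Relation_Operators.
From HB Require Import structures.
From mathcomp Require Import all_boot all_order all_algebra.
From mathcomp Require Import boolp wochoice classical_sets functions.
From mathcomp Require Import set_interval reals exp.

Set Implicit Arguments.
Unset Strict Implicit.
Unset Printing Implicit Defensive.

Import Order.TTheory GRing.Theory Num.Theory.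

Local Open Scope classical_set_scope.
Local Open Scope ring_scope.

Inductive expr : Type :=
  | One : expr
  | Add : expr -> expr -> expr
  | Mul : expr -> expr -> expr.

Fixpoint value (e : expr) : nat :=
  match e with
  | One => 1%N
  | Add e1 e2 => (value e1 + value e2)%N
  | Mul e1 e2 => (value e1 * value e2)%N
  end.

Fixpoint ones (e : expr) : nat :=
  match e with
  | One => 1%N
  | Add e1 e2 | Mul e1 e2 => (ones e1 + ones e2)%N
  end.

Definition writable (n m : nat) : Prop := exists e, value e = n /\ ones e = m.

(* The default value 0 is only reached at n = 0, see complexityP. *)
Definition complexity (n : nat) : nat :=
  xget 0%N [set m | writable n m /\ forall m', writable n m' -> (m <= m')%N].

Lemma complexityP (n : nat) : (0 < n)%N ->
  writable n (complexity n) /\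
  forall m, writable n m -> (complexity n <= m)%N.
Proof.
move=> n_gt0.
have exm : exists m, `[< writable n m >].
  exists n; apply/asboolP; case: n n_gt0 => // n _.
  elim: n => [|n [e [ve oe]]]; first by exists One.
  by exists (Add e One); split; rewrite /= ?ve ?oe addn1.
have [m /asboolP wm minm] := ex_minnP exm.
set P := [set m | writable n m /\ forall m', writable n m' -> (m <= m')%N].
apply: (@xgetPex _ 0%N P).
by exists m; split=> // m' wm'; apply/minm/asboolP.
Qed.

Section Defect.
Variable R : realType.

Definition log3 (x : R) : R := ln x / ln 3.

Definition defect (n : nat) : R := (complexity n)%:R - 3 * log3 n%:R.

Definition defect_set : set R := [set defect n | n in [set n | (0 < n)%N]].

End Defect.

(* Order types are represented by concrete strictly ordered types, with the
   usual ordinal operations. *)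
Record otype : Type := OType { ocar : Type; olt : ocar -> ocar -> Prop }.

Definition oone : otype := @OType unit (fun _ _ => False).

Definition oomega : otype := @OType nat (fun m n => (m < n)%N).

Definition oadd (a b : otype) : otype :=
  @OType (ocar a + ocar b)%type (le_AsB _ _ (@olt a) (@olt b)).

(* a * b is the concatenation of b copies of a: the b component is the most
   significant one in the lexicographic order. *)
Definition omul (a b : otype) : otype :=
  @OType (ocar b * ocar a)%type (slexprod _ _ (@olt b) (@olt a)).

Fixpoint oexp (a : otype) (k : nat) : otype :=
  if k is k'.+1 then omul (oexp a k') a else oone.

Section OrderType.
Variable R : realType.

Definition well_ordered (S : set R) : Prop :=
  wo_chain (<=%R : rel R) (mem S).

Lemma well_orderedP (S : set R) :
  well_ordered S <->
  forall A : set R, A `<=` S -> A !=set0 ->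
    exists m, A m /\ forall x, A x -> m <= x.
Proof.
split=> [wS A AS [a Aa]|wS A AS [a Aa]].
  have sub : sub_mem (mem A) (mem (mem S)).
    by move=> x; rewrite /in_mem /= => /set_mem/AS/mem_set.
  have [|m [[/set_mem Am lem] _]] := wS (mem A) sub.
    by exists a; apply: mem_set.
  by exists m; split=> // x Ax; apply/lem/mem_set.
have [x /AS xS||m [Am lem]] := wS [set x | x \in A]; first exact: set_mem xS.
  by exists a.
exists m; split; first by split.
by move=> y [yA ley]; apply/le_anti; rewrite lem //= ley.
Qed.

Definition has_order_type (S : set R) (a : otype) : Prop :=
  exists f : ocar a -> R,
    set_bij [set: ocar a] S f /\ forall x y, olt x y <-> f x < f y.

End OrderType.

(* Main.v *)
(**
Say that a set of reals is big of level [k] when it contains a copy of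
[omega^k]. The sets that are not big form an ideal, and a well-ordered set has
type [omega^k] iff it is big of level [k] while its proper initial segments are
not. Moreover, if [X] and [Y] are well-ordered and not big of levels [i] and
[j], the image of [X * Y] under a map nondecreasing in both variables is
well-ordered and not big of level [i + j - 1].

Upper bound: for [s < k] the defects below [s] are well-ordered and not big of
level [k], by induction on [s] in steps of the least positive defect. Up to
factors of defect [0], an optimal expression is either a product of two numbers
of positive defect, and the defects add up, or a sum [a + b] with [b <= a]. Then
[b] is bounded in terms of [s], and
[defect (a + b) = defect a + complexity b - 3 log3 (1 + b / a)] is nondecreasing
in [defect a] and [a]; apart from finitely many [a] this forces
[defect a < s - 1 + eps].

Lower bound: the numbers [(..(3^j1 + 1) 3^j2 + ..) 3^jk + 1], written in the
obvious way, have a nominal defect below [k], and these nominal defects are big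
of level [k]. When the obvious expression is not optimal, the true defect is
smaller by a positive integer, hence below [k - 1]; by the upper bound such
nominal defects are not big of level [k].
*)

Require Import Defs.
From Stdlib Require Import Relation_Operators.
From mathcomp Require Import all_boot all_order all_algebra.
From mathcomp Require Import boolp classical_sets functions.
From mathcomp Require Import set_interval reals exp.
From mathcomp Require Import zify ring lra.

Set Implicit Arguments.
Unset Strict Implicit.
Unset Printing Implicit Defensive.

Import Order.TTheory GRing.Theory Num.Theory.

Local Open Scope classical_set_scope.
Local Open Scope ring_scope.

(** * Sets of reals containing a copy of omega^k *)

Section OmegaPowers.
Variable R : realType.
Implicit Types (S T X Y A B : set R) (h : R -> R -> R).

(* [S] contains a copy of [omega^k]; the sets [T i] are consecutive blocks. *)
Fixpoint big (k : nat) (S : set R) : Prop :=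
  if k is k'.+1 then
    exists T : nat -> set R, [/\ forall i, T i `<=` S, forall i, big k' (T i) &
      forall i j x y, (i < j)%N -> T i x -> T j y -> x < y]
  else S !=set0.

Definition below S (x : R) : set R := S `&` [set y | y < x].

Lemma big_sub k S S' : S `<=` S' -> big k S -> big k S'.
Proof.
case: k => [|k] sSS' /=; first by case=> x /sSS'; exists x.
by case=> T [TS bT oT]; exists T; split=> // i x /TS/sSS'.
Qed.

Lemma big_nonempty k S : big k S -> S !=set0.
Proof.
elim: k S => [|k IH] S //= [T [TS bT _]].
by have [x /TS] := IH _ (bT 0%N); exists x.
Qed.

Lemma bigW k l S : (k <= l)%N -> big l S -> big k S.
Proof.
elim: l => [|l IH]; first by rewrite leqn0 => /eqP->.
rewrite leq_eqVlt => /predU1P[->//|lekl] [T [TS bT _]].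
by apply: IH => //; apply: big_sub (bT 0%N); apply: TS.
Qed.

(** Induction on [k] with a pigeonhole on the blocks. If infinitely many blocks have a big trace on
    [A], these traces are the blocks of a copy inside [A]; otherwise, from some index on, all traces
    on [B] are big. *)
Lemma bigU k A B : big k (A `|` B) -> big k A \/ big k B.
Proof.
elim: k A B => [|k IH] A B /=.
  by case=> x [Ax|Bx]; [left|right]; exists x.
case=> T [TAB bT oT].
have bTAB i : big k (T i `&` A) \/ big k (T i `&` B).
  by apply: IH; rewrite -setIUr; apply: big_sub (bT i) => x Tx; split=> //; apply: TAB Tx.
have [infA|/existsNP[N /forallNP finA]] :=
    pselect (forall N, exists i, (N <= i)%N /\ big k (T i `&` A)).
  have [g gP] := choice infA.
  pose n := fix n i := if i is i'.+1 then g (n i').+1 else g 0%N.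
  have nS i : (n i < n i.+1)%N by have [] := gP (n i).+1.
  have nlt i j : (i < j)%N -> (n i < n j)%N.
    by apply: (homo_ltn ltn_trans nS).
  left; exists (fun i => T (n i) `&` A).
  split=> [i x []//|i|i j x y /nlt nij [Tx _] [Ty _]].
    by case: i => [|i] /=; [have [] := gP 0%N | have [] := gP (n i).+1].
  exact: oT nij Tx Ty.
right; exists (fun i => T (N + i)%N `&` B).
split=> [i x []//|i|i j x y lij [Tx _] [Ty _]].
  by have [bA|//] := bTAB (N + i)%N; have := finA (N + i)%N; rewrite leq_addr; case.
by apply: oT Tx Ty; rewrite ltn_add2l.
Qed.

Lemma not_bigU k A B : ~ big k A -> ~ big k B -> ~ big k (A `|` B).
Proof. by move=> sA sB /bigU[]. Qed.

Definition finite_union (n : nat) (A : nat -> set R) : set R :=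
  [set x | exists2 i, (i < n)%N & A i x].

Lemma finite_unionS n (A : nat -> set R) :
  finite_union n.+1 A `<=` finite_union n A `|` A n.
Proof.
move=> x [i]; rewrite ltnS leq_eqVlt => /predU1P[-> Ax|lt Ax]; first by right.
by left; exists i.
Qed.

Lemma not_big_finite_union k n (A : nat -> set R) :
  (forall i, (i < n)%N -> ~ big k (A i)) -> ~ big k (finite_union n A).
Proof.
elim: n => [|n IH] sA; first by case/big_nonempty => x [].
move/(big_sub (@finite_unionS n A)); apply: not_bigU; last exact: sA.
by apply: IH => i /ltnW; apply: sA.
Qed.

Lemma not_big_set0 k : ~ big k set0.
Proof. by case/big_nonempty. Qed.

(** A point of the block [T 1] lies above the whole block [T 0], which is a copy of omega^k in its
    initial segment. *)
Lemma not_big_below k S : (forall x, S x -> ~ big k (below S x)) -> ~ big k.+1 S.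
Proof.
move=> sS [T [TS bT oT]]; have [x Tx] := big_nonempty (bT 1%N).
apply: (sS x); first exact: TS Tx.
by apply: big_sub (bT 0%N) => y Ty; split; [apply: TS Ty|apply: oT Ty Tx].
Qed.

Lemma not_big_set1 (x : R) : ~ big 1 [set x].
Proof.
apply: not_big_below => y /= -> [z [/= -> ]].
by rewrite /= ltxx.
Qed.

(** Each piece is nonempty, which forces [c i <= c i.+1]; the pieces are thus consecutive blocks. *)
Lemma big_cuts k S (c : nat -> R) :
  (forall i, big k (S `&` [set x | c i <= x < c i.+1])) -> big k.+1 S.
Proof.
move=> bc; exists (fun i => S `&` [set x | c i <= x < c i.+1]).
split=> [i x []//|//|i j x y lij [_ /= /andP[_ xi]] [_ /= /andP[jy _]]].
apply: lt_le_trans jy; apply: (lt_le_trans xi).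
apply: (homo_leq (r := <=%R)) lij => // [a b d|n]; first exact: le_trans.
by have [z [_ /= /andP[/le_lt_trans a /a /ltW]]] := big_nonempty (bc n).
Qed.

(** * Well-ordered sets of reals *)

Lemma well_ordered_min S A : well_ordered S -> A `<=` S -> A !=set0 ->
  exists m, A m /\ forall x, A x -> m <= x.
Proof. by move/well_orderedP; apply. Qed.

Lemma well_ordered_sub S S' : S `<=` S' -> well_ordered S' -> well_ordered S.
Proof.
move=> SS' /well_orderedP woS; apply/well_orderedP => A AS.
by apply: woS => x /AS/SS'.
Qed.

Lemma well_orderedU A B : well_ordered A -> well_ordered B -> well_ordered (A `|` B).
Proof.
move=> woA woB; apply/well_orderedP => C CAB [c Cc].
have [[a0 CA0]|noA] := pselect (C `&` A !=set0); last first.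
  apply: (well_ordered_min woB); last by exists c.
  by move=> x Cx; have [Ax|//] := CAB x Cx; case: noA; exists x.
have [[b0 CB0]|noB] := pselect (C `&` B !=set0); last first.
  apply: (well_ordered_min woA); last by exists c.
  by move=> x Cx; have [//|Bx] := CAB x Cx; case: noB; exists x.
have [||a [[Ca _] amin]] := well_ordered_min woA (A := C `&` A);
  [by move=> x []|by exists a0|].
have [||b [[Cb _] bmin]] := well_ordered_min woB (A := C `&` B);
  [by move=> x []|by exists b0|].
exists (Num.min a b); split; first by case: leP.
by move=> x Cx; rewrite ge_min; case: (CAB x Cx) => [Ax|Bx];
  [rewrite amin | rewrite bmin ?orbT].
Qed.

Lemma well_ordered_set1 (x : R) : well_ordered [set x].
Proof.
by apply/well_orderedP => A Ax [y Ay]; exists y; split=> // z /Ax ->; rewrite (Ax _ Ay).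
Qed.

Lemma well_ordered_set0 : well_ordered (set0 : set R).
Proof. by apply/well_orderedP => A A0 [y /A0]. Qed.

Lemma well_ordered_finite_union n (A : nat -> set R) :
  (forall i, (i < n)%N -> well_ordered (A i)) -> well_ordered (finite_union n A).
Proof.
elim: n => [|n IH] sA.
  by apply: well_ordered_sub well_ordered_set0 => x [].
apply: (well_ordered_sub (@finite_unionS n A)).
apply: well_orderedU; last exact: sA.
by apply: IH => i /ltnW; apply: sA.
Qed.

(** * Greedy cutting of a well-ordered set into blocks *)

Lemma next_cut k S (c : R) : well_ordered S ->
  (exists x, S x /\ big k (S `&` [set y | c <= y < x])) ->
  exists c', [/\ S c', big k (S `&` [set y | c <= y < c']) &
    forall x, S x -> x < c' -> ~ big k (S `&` [set y | c <= y < x])].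
Proof.
move=> woS ex.
have [|c' [[Sc bc] minc]] := well_ordered_min woS
  (A := [set x | S x /\ big k (S `&` [set y | c <= y < x])]) _ ex; first by move=> x [].
by exists c'; split=> // x Sx xc bx; move: (minc x (conj Sx bx)); rewrite leNgt xc.
Qed.

(* A well-ordered set of type less than [omega^(k+1)] is a finite union of
   intervals of type at most [omega^k], obtained greedily; hence it is enough to
   check an ideal property on the latter. *)
Lemma not_big_ind k (P : set R -> Prop) S :
  (forall A B, P A -> P B -> P (A `|` B)) ->
  (forall A, A `<=` S -> (forall x, A x -> ~ big k (below A x)) -> P A) ->
  well_ordered S -> ~ big k.+1 S -> P S.
Proof.
move=> PU Pind woS sS; apply: contrapT => nPS.
have [x0 Sx0] : S !=set0.
  by apply: contrapT => S0; apply/nPS/Pind => // x Sx; case: S0; exists x.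
have [c0 [Sc0 c0min]] : exists m, S m /\ forall x, S x -> m <= x.
  by apply: (well_ordered_min woS) => //; exists x0.
(* [Q c] says that [P] fails on the tail from [c]. Such a tail has a next cut [c'], for otherwise
   its initial segments would not be big and [Pind] would apply. The piece from [c] to [c']
   satisfies [P], so the tail from [c'] fails again; iterating yields a copy of omega^(k+1). *)
pose Q c := S c /\ ~ P (S `&` [set y | c <= y]).
have nextP c : exists c', Q c -> Q c' /\ big k (S `&` [set y | c <= y < c']).
  have [[Sc nPc]|nQ] := pselect (Q c); last by exists 0 => /nQ.
  have [|c' [Sc' bc' mc']] := @next_cut k S c woS.
    apply: contrapT => /forallNP nex; apply: nPc; apply: Pind => [x []//|x [Sx cx] bx].
    apply: (nex x); split=> //; apply: big_sub bx => y [[Sy /= cy] /= yx].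
    by split=> //=; rewrite cy.
  exists c' => _; split=> //; split=> // Pc'; apply: nPc.
  have -> : S `&` [set y | c <= y] =
      (S `&` [set y | c <= y < c']) `|` (S `&` [set y | c' <= y]).
    have cc' : c <= c'.
      by have [z [_ /= /andP[/le_lt_trans a /a /ltW]]] := big_nonempty bc'.
    apply/seteqP; split=> y /= => [[Sy cy]|[[Sy /andP[]]|[Sy cy]]] //.
      by case: (ltP y c') => cy'; [left|right]; rewrite ?cy.
    by split=> //; apply: le_trans cy.
  apply: PU => //; apply: Pind => [x []//|x [Sx /= /andP[cx xc']] bx].
  apply: (mc' x) => //; apply: big_sub bx => y [[Sy /= /andP[cy _]] /= yx].
  by split=> //=; rewrite cy.
have [nx nxP] := choice nextP.
have Qn i : Q (iter i nx c0).
  elim: i => [|i /nxP[]//]; split=> //= PS; apply: nPS.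
  rewrite (_ : S = S `&` [set y | c0 <= y]) //; apply/seteqP.
  by split=> [y Sy|y []//]; split=> //=; apply: c0min.
by apply/sS/(@big_cuts k S (fun i => iter i nx c0)) => i; have [] := nxP _ (Qn i).
Qed.

(** * Images of products under monotone maps *)

Definition image2 h X Y : set R := [set z | exists x y, [/\ X x, Y y & h x y = z]].

Lemma image2_Ul h X X' Y : image2 h (X `|` X') Y = image2 h X Y `|` image2 h X' Y.
Proof.
apply/seteqP; split=> z; first by case=> x [y [[Xx|Xx] Yy <-]]; [left|right]; exists x, y.
by case=> -[x [y [Xx Yy <-]]]; exists x, y; split=> //; [left|right].
Qed.

Lemma image2_Ur h X Y Y' : image2 h X (Y `|` Y') = image2 h X Y `|` image2 h X Y'.
Proof.
apply/seteqP; split=> z; first by case=> x [y [Xx [Yy|Yy] <-]]; [left|right]; exists x, y.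
by case=> -[x [y [Xx Yy <-]]]; exists x, y; split=> //; [left|right].
Qed.

(** By monotonicity, a pair with a value below [h x y] has a first component below [x] or a second
    one below [y]. *)
Lemma image2_below h X Y x y :
  (forall x x' y y', X x -> X x' -> Y y -> Y y' ->
     x <= x' -> y <= y' -> h x y <= h x' y') ->
  X x -> Y y ->
  below (image2 h X Y) (h x y) `<=` image2 h (below X x) Y `|` image2 h X (below Y y).
Proof.
move=> hmono Xx Yy z [[x' [y' [Xx' Yy' <-]]] /= lt_h].
have [lx|lex] := ltP x' x; first by left; exists x', y'.
have [ly|ley] := ltP y' y; first by right; exists x', y'.
by move: lt_h; rewrite ltNge hmono.
Qed.

(** Induction on [i + j]. By [not_big_ind] in each variable, the factors may be assumed to have
    initial segments that are not big of one level less. An initial segment of the image is then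
    covered by two images in which one factor has dropped a level. *)
Lemma not_big_image2 h i j X Y : well_ordered X -> well_ordered Y ->
  (forall x x' y y', X x -> X x' -> Y y -> Y y' ->
     x <= x' -> y <= y' -> h x y <= h x' y') ->
  ~ big i X -> ~ big j Y -> ~ big (i + j).-1 (image2 h X Y).
Proof.
have [n] := ubnP (i + j); elim: n => // n IH in i j X Y *.
case: i => [|i] lt_ij woX woY hmono.
  by move=> X0 _ /big_nonempty[_ [x [y [Xx _ _]]]]; apply: X0; exists x.
case: j => [|j] in lt_ij *.
  by move=> _ Y0 /big_nonempty[_ [x [y [_ Yy _]]]]; apply: Y0; exists y.
rewrite addSn addnS /= in lt_ij *.
move=> sX sY.
apply: (@not_big_ind i (fun X => ~ big (i + j).+1 (image2 h X Y)) X) => //.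
  by move=> A B sA sB; rewrite image2_Ul; apply: not_bigU.
move=> A AX sA.
apply: (@not_big_ind j (fun Y => ~ big (i + j).+1 (image2 h A Y)) Y) => //.
  by move=> C B sC sB; rewrite image2_Ur; apply: not_bigU.
move=> B BY sB; apply: not_big_below => _ [x [y [Ax By <-]]].
have hAB x1 x2 y1 y2 : A x1 -> A x2 -> B y1 -> B y2 ->
    x1 <= x2 -> y1 <= y2 -> h x1 y1 <= h x2 y2.
  by move=> /AX ? /AX ? /BY ? /BY ?; apply: hmono.
have woA := well_ordered_sub AX woX; have woB := well_ordered_sub BY woY.
have bA z : below A z `<=` A by move=> ? [].
have bB z : below B z `<=` B by move=> ? [].
move=> /(big_sub (image2_below hAB Ax By)); apply: not_bigU.
  rewrite -[(i + j)%N]/((i + j).+1.-1) -addnS; apply: IH => //.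
  - by rewrite addnS.
  - exact: well_ordered_sub woA.
  - by move=> x1 x2 y1 y2 /bA ? /bA ?; apply: hAB.
  - exact: sA.
  - by move=> bB'; apply: sY; apply: big_sub bB'.
rewrite -[(i + j)%N]/((i + j).+1.-1) -addSn; apply: IH => //.
- exact: well_ordered_sub woB.
- by move=> x1 x2 y1 y2 ? ? /bB ? /bB ?; apply: hAB.
- by move=> bA'; apply: sX; apply: big_sub bA'.
- exact: sB.
Qed.

Lemma well_ordered_image2 h X Y : well_ordered X -> well_ordered Y ->
  (forall x x' y y', X x -> X x' -> Y y -> Y y' ->
     x <= x' -> y <= y' -> h x y <= h x' y') ->
  well_ordered (image2 h X Y).
Proof.
move=> woX woY hmono.
pose hasmin (U : R -> R -> Prop) :=
  exists x y, U x y /\ forall x' y', U x' y' -> h x y <= h x' y'.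
pose sub (U : R -> R -> Prop) := forall x y, U x y -> X x /\ Y y.
(* Pairs of [U] beating one with least second component have a smaller first
   component. *)
have step (U : R -> R -> Prop) x0 y0 : sub U -> U x0 y0 ->
    (forall x y V, U x y -> sub V -> (exists x' y', V x' y') ->
       (forall x' y', V x' y' -> x' < x) -> hasmin V) -> hasmin U.
  move=> sU U0 IH.
  have [||ym [[xm Um] ymin]] := well_ordered_min woY (A := [set y | exists x, U x y]).
  - by move=> y [x /sU[]].
  - by exists y0, x0.
  have [Xm Ym] := sU _ _ Um.
  pose V x y := U x y /\ h x y < h xm ym.
  have [[x1 [y1 V1]]|nV] := pselect (exists x y, V x y); last first.
    exists xm, ym; split=> // x y Uxy; rewrite leNgt; apply/negP => lt.
    by apply: nV; exists x, y.
  have [|||x [y [[Uxy lt] min]]] := IH xm ym V Um.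
  - by move=> x y [/sU].
  - by exists x1, y1.
  - move=> x y [Uxy lt]; have [Xx Yy] := sU _ _ Uxy.
    rewrite ltNge; apply/negP => le; move: lt; rewrite ltNge hmono //.
    by apply: ymin; exists x.
  exists x, y; split=> // x' y' U'.
  have [l|l] := ltP (h x' y') (h xm ym); first exact: min.
  by apply: ltW; apply: lt_le_trans l.
have bounded x V : X x -> sub V -> (exists x' y', V x' y') ->
    (forall x' y', V x' y' -> x' < x) -> hasmin V.
  move=> Xx sV exV ltV; apply: contrapT => nV.
  (* Well-founded induction on the bound for first components: for a set without minimum below the
     least bad bound, [step] would produce a smaller bad bound. *)
  pose bad x := exists V, [/\ X x, sub V, exists x' y', V x' y',
    forall x' y', V x' y' -> x' < x & ~ hasmin V].
  have [||m [[W [Xm sW [x1 [y1 W1]] ltW nW]] mmin]] := well_ordered_min woX (A := bad).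
  - by move=> z [? []].
  - by exists x, V.
  apply: nW; apply: (step _ _ _ sW W1) => z y V' Wz sV' exV' ltV'.
  apply: contrapT => nV'.
  have: bad z by exists V'; split=> //; case: (sW _ _ Wz).
  by move/mmin; rewrite leNgt (ltW _ _ Wz).
apply/well_orderedP => A AXY [z0 Az0].
have [x0 [y0 [Xx0 Yy0 h0]]] := AXY _ Az0.
pose U x y := [/\ X x, Y y & A (h x y)].
have [|||x [y [[Xx Yy Ah] min]]] := step U x0 y0.
- by move=> x y [].
- by split; rewrite ?h0.
- by move=> x y V [Xx _ _]; apply: bounded.
exists (h x y); split=> // z Az.
by have [x' [y' [Xx' Yy' hz]]] := AXY _ Az; rewrite -hz; apply: min; split; rewrite ?hz.
Qed.

(** Greedy cuts split [S] into consecutive intervals, each of type omega^k by induction. They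
    exhaust [S]: a point above all cuts would have a copy of omega^(k+1) below it. *)
Lemma has_order_type_omega_pow k S : well_ordered S -> big k S ->
  (forall x, S x -> ~ big k (below S x)) -> has_order_type S (oexp oomega k).
Proof.
elim: k S => [|k IH] S woS bS sS.
  have [x0 Sx0] := bS.
  have Sx x : S x -> x = x0.
    have lt y z : S y -> S z -> ~~ (y < z).
      by move=> Sy Sz; apply/negP => yz; apply: (sS z Sz); exists y.
    by move=> Sx; apply/le_anti; rewrite !leNgt !lt.
  exists (fun=> x0); split; last by move=> /= [] []; rewrite ltxx.
  split=> [x _ //|[] [] //|x /Sx -> /=]; by exists tt.
have nextP c : exists c', S c -> [/\ S c', big k (S `&` [set y | c <= y < c']) &
    forall x, S x -> x < c' -> ~ big k (S `&` [set y | c <= y < x])].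
  have [Sc|nSc] := pselect (S c); last by exists 0 => /nSc.
  suff [c' c'P] : exists c', [/\ S c', big k (S `&` [set y | c <= y < c']) &
    forall x, S x -> x < c' -> ~ big k (S `&` [set y | c <= y < x])] by exists c'.
  apply: next_cut => //; have [T [TS bT oT]] := bS.
  (* Some block reaches [c], since otherwise all of them would lie below [c]. The block after it
     then lies between [c] and any point of the second block after it. *)
  have [i [y [Ty cy]]] : exists i y, T i y /\ c <= y.
    apply: contrapT => nex; apply: (sS c Sc); exists T; split=> // i x Tx.
    split; first exact: TS Tx.
    by rewrite /= ltNge; apply/negP => cx; apply: nex; exists i, x.
  have [x Tx] := big_nonempty (bT i.+2).
  exists x; split; first exact: TS Tx.
  apply: big_sub (bT i.+1) => z Tz; split; first exact: TS Tz.
  by rewrite /= (le_trans cy (ltW (oT _ _ _ _ (ltnSn i) Ty Tz)))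
    (oT _ _ _ _ (ltnSn _) Tz Tx).
have [nx nxP] := choice nextP.
have [||c0 [Sc0 c0min]] := well_ordered_min woS (A := S); [by []|exact: big_nonempty bS|].
pose c i := iter i nx c0.
have Sc i : S (c i) by elim: i => //= i Sci; have [] := nxP _ Sci.
pose P i := S `&` [set y | c i <= y < c i.+1].
have bP i : big k (P i) by have [] := nxP _ (Sc i).
have cS i : c i <= c i.+1.
  by have [z [_ /= /andP[/le_lt_trans a /a /ltW]]] := big_nonempty (bP i).
have cle i j : (i <= j)%N -> c i <= c j.
  by apply: (homo_leq (r := <=%R)) => // a b d; apply: le_trans.
have cover x : S x -> exists i, P i x.
  move=> Sx; have [[n xn]|nex] := pselect (exists n, x < c n).
    have [[|m] xm minm] := ex_minnP (ex_intro (fun n => x < c n) n xn).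
      by move: xm; rewrite /= ltNge c0min.
    exists m; split=> //=; rewrite leNgt xm andbT; apply/negP => /minm.
    by rewrite ltnn.
  case: (sS x Sx); apply: (@big_cuts k _ c) => i; apply: big_sub (bP i) => y [Sy /= cy].
  do !split=> //=; case/andP: cy => _ /lt_le_trans; apply.
  by rewrite leNgt; apply/negP => ?; apply: nex; exists i.+1.
have otP i : has_order_type (P i) (oexp oomega k).
  apply: IH => //.
    by apply: well_ordered_sub woS => x [].
  move=> x [Sx /= /andP[cx xc]] bx; have [_ _ /(_ x Sx xc)] := nxP _ (Sc i).
  by apply; apply: big_sub bx => y [[Sy /= /andP[cy _]] /= yx]; split=> //=; rewrite cy.
have [f fP] := choice otP.
have Pf i u : P i (f i u) by have [[fi _ _] _] := fP i; apply: fi.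
have flt i j u v : (i < j)%N -> f i u < f j v.
  move=> ij; have [_ /= /andP[_ l1]] := Pf i u; have [_ /= /andP[l2 _]] := Pf j v.
  by exact: lt_le_trans (lt_le_trans l1 (cle i.+1 j ij)) l2.
exists (fun p : ocar (oexp oomega k.+1) => f p.1 p.2); split.
  split=> [[i u] _|[i u] [j v] _ _ /= efg|x Sx].
  - by have [] := Pf i u.
  - have ij : i = j.
      by case: (ltngtP i j) => // /flt lt; [have := lt u v|have := lt v u];
         rewrite efg ltxx.
    rewrite -ij in efg *; congr (_, _); have [[_ inj _] _] := fP i.
    by apply: inj; rewrite ?in_setE.
  - have [i Pix] := cover x Sx; have [[_ _ surj] _] := fP i.
    by have [u _ <-] := surj x Pix; exists (i, u).
move=> [i u] [j v]; split.
  case=> /= [i' j' u' v' lt|i' u' v' lt]; first exact: flt.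
  by have [_ fi] := fP i'; apply/fi.
move=> /= lt; case: (ltngtP i j) => ij.
- exact: left_slex.
- by have := flt _ _ v u ij; rewrite ltNge (ltW lt).
- by rewrite -ij in lt *; apply: right_slex; have [_ fi] := fP i; apply/fi.
Qed.

(* [omega^(k+1) = omega * omega^k]: it suffices to find a copy of [omega] just
   below the translate of each point of a copy of [omega^k]. *)
Lemma big_approached k (t : R) X S : big k X ->
  (forall x y, X x -> y < x + t -> big 1 (S `&` [set s | y <= s < x + t])) ->
  big k.+1 S.
Proof.
elim: k X S => [|k IH] X S bX SX.
  have [x Xx] := bX.
  by apply: big_sub (SX x (x + t - 1) Xx _); [move=> ? []|rewrite ltrBlDr ltrDl].
have [T [TX bT oT]] := bX.
(* Even blocks supply separators [w i], odd blocks the points whose translates are approached; the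
   separators keep the new blocks apart. *)
have [w wP] := choice (fun i => big_nonempty (bT (i.*2))).
exists (fun i => S `&` [set s | w i + t <= s /\ exists x, T i.*2.+1 x /\ s < x + t]).
split=> [i x []//|i|i j s s' ij [_ /= [_ [x [Tx sx]]]] [_ /= [ws _]]].
  apply: (IH (T i.*2.+1)) => [|x y Tx yx]; first exact: bT.
  apply: big_sub (SX x (Num.max y (w i + t)) _ _).
  - move=> s [Ss /=]; rewrite ge_max => /andP[/andP[ys ws] sx].
    by do !split=> //=; [exists x|rewrite ys].
  - exact: TX Tx.
  - rewrite gt_max yx ltrD2r /=; exact: oT (ltnSn _) (wP i) Tx.
apply: lt_le_trans ws; apply: (lt_trans sx); rewrite ltrD2r.
by apply: oT Tx (wP j); rewrite -doubleS leq_double.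
Qed.

End OmegaPowers.

(** * Expressions and integer complexity *)

Section Defects.
Variable R : realType.

Lemma value_gt0 e : (0 < value e)%N.
Proof.
by elim: e => //= e1 IH1 e2 IH2; [rewrite addn_gt0 IH1|rewrite muln_gt0 IH1].
Qed.

Lemma writable_gt0 n m : writable n m -> (0 < n)%N.
Proof. by case=> e [<- _]; apply: value_gt0. Qed.

Lemma writable1 : writable 1 1.
Proof. by exists One. Qed.

Lemma writableD n m n' m' : writable n m -> writable n' m' -> writable (n + n') (m + m').
Proof. by move=> [e [<- <-]] [e' [<- <-]]; exists (Add e e'). Qed.

Lemma writableM n m n' m' : writable n m -> writable n' m' -> writable (n * n') (m + m').
Proof. by move=> [e [<- <-]] [e' [<- <-]]; exists (Mul e e'). Qed.

Lemma writable3X j : (0 < j)%N -> writable (3 ^ j) (3 * j).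
Proof.
have w3 : writable 3 3 by exists (Add One (Add One One)).
case: j => // j _; elim: j => [|j IH] //.
by rewrite expnS mulnS; apply: writableM.
Qed.

Lemma complexity_min n m : writable n m -> (complexity n <= m)%N.
Proof. by move=> w; have [_] := complexityP (writable_gt0 w); apply. Qed.

Lemma complexityW n : (0 < n)%N -> writable n (complexity n).
Proof. by case/complexityP. Qed.

Lemma complexity1 : complexity 1 = 1%N.
Proof.
apply/eqP; rewrite eqn_leq (complexity_min writable1) /=.
have [e [_ <-]] := complexityW (ltnSn 0).
by elim: e => //= e1 IH1 e2 IH2; rewrite ltn_addr.
Qed.

(** Integer form of a gap between defects: [9 / 8] is the ratio of [3 ^ 2] to [2 ^ 3], attained at
    the value 2 with two ones. Induction on the expression; only a summand with a single one needs a
    separate treatment. *)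
Lemma cube_gap e :
  (value e ^ 3 = 3 ^ ones e \/ 9 * value e ^ 3 <= 8 * 3 ^ ones e)%N.
Proof.
have cube_le (x y : nat) : (x = y \/ 9 * x <= 8 * y -> x <= y)%N by lia.
elim: e => [|e1 IH1 e2 IH2|e1 IH1 e2 IH2] /=; first by right.
- have gt0 := value_gt0; move: (gt0 e1) (gt0 e2) => v1 v2.
  have {}IH1 := cube_le _ _ IH1; have {}IH2 := cube_le _ _ IH2.
  have cubeD1 a m : (0 < a -> a ^ 3 <= 3 ^ m -> 0 < m ->
      (a + 1) ^ 3 = 3 ^ (m + 1) \/ 9 * (a + 1) ^ 3 <= 8 * 3 ^ (m + 1))%N.
    (* The exponents 1 and 2 are checked by hand, with equality at [2 + 1 = 3]. From 3 on, the main
       case is [a >= 3], where [a + 1] is at most [4 a / 3], and [(4 / 3) ^ 3 < 8 / 3]. *)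
    move=> a_gt0; case: m => [|[|[|m]]] // am _.
    + have -> : a = 1%N by case: a a_gt0 am => [|[|a]] //; rewrite !expnS; nia.
      by right.
    + have : (a <= 2)%N by case: a a_gt0 am => [|[|[|a]]] //; rewrite !expnS; nia.
      by case: a a_gt0 {am} => [|[|[|a]]] // _ _; [right|left].
    + right; have P27 : (27 <= 3 ^ m.+3)%N by rewrite -[27%N]/(3 ^ 3)%N leq_exp2l.
      rewrite addn1 [in leqRHS]expnD; move: (3 ^ m.+3)%N am P27 => P.
      rewrite !expnS expn0.
      case: (ltnP a 3) => a3; first by case: a a_gt0 a3 => [|[|[|a]]] //; lia.
      have e3 : (3 * a.+1 <= 4 * a)%N by lia.
      have : ((3 * a.+1) * ((3 * a.+1) * (3 * a.+1)) <= (4 * a) * ((4 * a) * (4 * a)))%N.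
        by do 2 apply: leq_mul => //.
      lia.
  have one_cost v m : (0 < v -> v ^ 3 <= 3 ^ m -> m = 1 -> v = 1)%N.
    by move=> v_gt0 + m1; rewrite m1; case: v v_gt0 => [|[|v]] //; rewrite !expnS; nia.
  have ones_gt0 e : (0 < ones e)%N by elim: e => //= ? ? ? ?; rewrite ltn_addr.
  move: (ones_gt0 e1) (ones_gt0 e2) v1 v2 IH1 IH2.
  move: (ones e1) (ones e2) (value e1) (value e2).
  move=> m1 m2 a b m1_gt0 m2_gt0 a_gt0 b_gt0 am bm.
  have [m21|m22] : (m2 = 1 \/ 2 <= m2)%N by lia.
    rewrite (one_cost _ _ b_gt0 bm m21) m21; exact: cubeD1.
  have [m11|m12] : (m1 = 1 \/ 2 <= m1)%N by lia.
    rewrite (one_cost _ _ a_gt0 am m11) m11 [(1 + b)%N]addnC [(1 + m2)%N]addnC.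
    exact: cubeD1.
  right; have P9 : (9 <= 3 ^ m1)%N by rewrite -[9%N]/(3 ^ 2)%N leq_exp2l.
  have Q9 : (9 <= 3 ^ m2)%N by rewrite -[9%N]/(3 ^ 2)%N leq_exp2l.
  (* Convexity of the cube; then [9 * 4 * (P + Q) <= 8 * P * Q] because [P] and [Q] are at least
     9. *)
  have cubes : ((a + b) ^ 3 <= 4 * (a ^ 3 + b ^ 3))%N.
    rewrite !expnS !expn0 !muln1.
    have [[d ->]|[d ->]] : (exists d, b = (a + d)%N) \/ (exists d, a = (b + d)%N).
      by case: (leqP a b) => ab; [left; exists (b - a)%N|right; exists (a - b)%N]; lia.
    - nia.
    - nia.
  rewrite expnD; move: (3 ^ m1)%N (3 ^ m2)%N am bm P9 Q9 => P Q; nia.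
- rewrite !expnMn expnD.
  move: IH1 IH2; set x := (value e1 ^ 3)%N; set y := (value e2 ^ 3)%N.
  case=> [->|x1]; case=> [->|y1]; [by left|right; nia|right; nia|right].
  apply: leq_trans (_ : 8 * 3 ^ ones e1 * y <= _)%N; first by nia.
  by have := cube_le _ _ (or_intror y1); nia.
Qed.

(** * Logarithms to base 3 and the decomposition of defects *)

Local Notation log3 := (@log3 R).
Local Notation defect := (@defect R).
Local Notation defect_set := (@defect_set R).

Lemma ln3_gt0 : 0 < ln (3 : R).
Proof. by rewrite ln_gt0 // ltr1n. Qed.

Lemma log3M (x y : R) : 0 < x -> 0 < y -> log3 (x * y) = log3 x + log3 y.
Proof. by move=> x0 y0; rewrite /Defs.log3 lnM // mulrDl. Qed.

Lemma log3X (x : R) n : 0 < x -> log3 (x ^+ n) = n%:R * log3 x.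
Proof. by move=> x0; rewrite /Defs.log3 lnXn // mulr_natl mulrnAl. Qed.

Lemma log3_3 : log3 3 = 1.
Proof. by rewrite /Defs.log3 divff // gt_eqF // ln3_gt0. Qed.

Lemma log3_3X n : log3 (3 ^+ n) = n%:R.
Proof. by rewrite log3X // log3_3 mulr1. Qed.

Lemma log3_1 : log3 1 = 0.
Proof. by rewrite /Defs.log3 ln1 mul0r. Qed.

Lemma ler_log3 (x y : R) : 0 < x -> x <= y -> log3 x <= log3 y.
Proof.
move=> x0 xy; rewrite /Defs.log3 ler_pM2r ?invr_gt0 ?ln3_gt0 //.
by rewrite ler_ln // posrE // (lt_le_trans x0).
Qed.

Lemma ltr_log3 (x y : R) : 0 < x -> x < y -> log3 x < log3 y.
Proof.
move=> x0 xy; rewrite /Defs.log3 ltr_pM2r ?invr_gt0 ?ln3_gt0 //.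
by rewrite ltr_ln // posrE // (lt_trans x0).
Qed.

Lemma log3_inj (x y : R) : 0 < x -> 0 < y -> log3 x = log3 y -> x = y.
Proof.
move=> x0 y0 /(mulIf _) exy; apply: ln_inj; rewrite ?posrE //; apply: exy.
by rewrite invr_eq0 gt_eqF // ln3_gt0.
Qed.

Lemma log3_cube n : (0 < n)%N -> 3 * log3 n%:R = log3 (n ^ 3)%:R.
Proof. by move=> n0; rewrite natrX log3X // ltr0n. Qed.

(* The defect of 2. *)
Definition gap : R := log3 (9 / 8).

Lemma gap_gt0 : 0 < gap.
Proof. by rewrite -log3_1; apply: ltr_log3 => //; lra. Qed.

(** Since [(9 / 8) ^ 2 <= 3]. It makes a drop of one half in the bound on defects cover a full
    induction step of size [gap]. *)
Lemma gap_le_half : gap <= 2^-1.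
Proof.
suff : 2%:R * gap <= 1 by lra.
rewrite -log3X; last by lra.
by rewrite -[leRHS]log3_3; apply: ler_log3; rewrite expr2; lra.
Qed.

Lemma defect_gap n : (0 < n)%N -> defect n = 0 \/ gap <= defect n.
Proof.
move=> n0; rewrite /Defs.defect log3_cube //.
have [e [<- <-]] := complexityW n0; have v0 := value_gt0 e.
have [->|le] := cube_gap e; [left|right].
  by rewrite natrX log3_3X subrr.
rewrite lerBrDr -[leRHS]log3_3X -log3M ?ltr0n ?expn_gt0 ?v0 //; last by lra.
apply: ler_log3; first by apply: mulr_gt0; rewrite ?ltr0n ?expn_gt0 ?v0 //; lra.
have : (9 * value e ^ 3)%:R <= (8 * 3 ^ ones e)%:R :> R by rewrite ler_nat.
by rewrite !natrM (natrX R 3); lra.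
Qed.

Lemma defect_ge0 n : (0 < n)%N -> 0 <= defect n.
Proof. by case/defect_gap => [->//|]; apply: le_trans; rewrite ltW // gap_gt0. Qed.

Lemma defect1 : defect 1 = 1.
Proof. by rewrite /Defs.defect complexity1 log3_1 mulr0 subr0. Qed.

(** In an optimal expression both operands are optimal. A factor of defect 0 is discarded, and the
    induction continues with the other factor, which has the same defect as the product. *)
Lemma defect_cases n : (0 < n)%N ->
  [\/ defect n = 0, defect n = 1,
      exists u v, [/\ (0 < u)%N, (0 < v)%N, gap <= defect u, gap <= defect v &
        defect n = defect u + defect v] |
      exists a b, [/\ (0 < b)%N, (b <= a)%N &
        defect n = defect a + (complexity b)%:R - 3 * log3 (1 + b%:R / a%:R)]].
Proof.
move=> /complexityW[e]; elim: e n => [|e1 _ e2 _|e1 IH1 e2 IH2] n [<- on].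
- by apply: Or42; rewrite defect1.
- apply: Or44; set a := value e1; set b := value e2.
  have a0 : (0 < a)%N := value_gt0 e1; have b0 : (0 < b)%N := value_gt0 e2.
  have la : (complexity a <= ones e1)%N by apply: complexity_min; exists e1.
  have lb : (complexity b <= ones e2)%N by apply: complexity_min; exists e2.
  have := complexity_min (writableD (complexityW a0) (complexityW b0)).
  have E (x y : nat) : (0 < x)%N -> (0 < y)%N ->
    complexity (x + y) = (complexity x + complexity y)%N ->
    defect (x + y) = defect x + (complexity y)%:R - 3 * log3 (1 + y%:R / x%:R).
    move=> x0 y0 c; rewrite /Defs.defect c natrD.
    have -> : (x + y)%:R = x%:R * (1 + y%:R / x%:R) :> R.
      by rewrite mulrDr mulr1 mulrCA divff ?mulr1 ?natrD // pnatr_eq0 -lt0n.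
    rewrite log3M ?ltr0n //; first by ring.
    by rewrite ltr_wpDr // divr_ge0.
  move: on => /= on le; rewrite -/a -/b in on *.
  case: (leqP b a) => ab.
    by exists a, b; split=> //; apply: E => //; lia.
  exists b, a; rewrite [(a + b)%N]addnC; split=> //; first exact: ltnW.
  by apply: E => //; rewrite addnC; lia.
- set a := value e1; set b := value e2.
  have a0 : (0 < a)%N := value_gt0 e1; have b0 : (0 < b)%N := value_gt0 e2.
  have la : (complexity a <= ones e1)%N by apply: complexity_min; exists e1.
  have lb : (complexity b <= ones e2)%N by apply: complexity_min; exists e2.
  have := complexity_min (writableM (complexityW a0) (complexityW b0)).
  move: on => /= on le; rewrite -/a -/b in on *.
  have oa : ones e1 = complexity a by lia.
  have ob : ones e2 = complexity b by lia.
  have dM : defect (a * b) = defect a + defect b.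
    by rewrite /Defs.defect -on oa ob natrD natrM log3M ?ltr0n //; ring.
  have [da|da] := defect_gap a0.
    by rewrite dM da add0r; apply: IH2.
  have [db|db] := defect_gap b0.
    by rewrite dM db addr0; apply: IH1.
  by apply: Or43; exists a, b.
Qed.

Lemma log3_1Dx (x : R) : 0 <= x -> log3 (1 + x) <= x / ln 3.
Proof.
move=> x0; rewrite /Defs.log3 ler_pM2r ?invr_gt0 ?ln3_gt0 //.
by apply: le_ln1Dx; lra.
Qed.

(** The correction term of a sum tends to 0 as the larger summand grows; [N] comes from the bound
    [ln (1 + x) <= x]. *)
Lemma three_log3_lt (c e : R) : 0 <= c -> 0 < e ->
  exists N, forall y : R, N%:R <= y -> 0 < y /\ 3 * log3 (1 + c / y) < e.
Proof.
move=> c0 e0; exists (Num.truncn (3 * c / ln 3 / e)).+1 => y.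
move=> /(lt_le_trans (truncnS_gt _)) lty; have ln0 := ln3_gt0.
have y0 : 0 < y by apply: le_lt_trans lty; rewrite !divr_ge0 ?mulr_ge0 // ltW.
split=> //; apply: le_lt_trans (_ : 3 * (c / y / ln 3) < _).
  by rewrite ler_pM2l //; apply: log3_1Dx; rewrite divr_ge0 // ltW.
have -> : 3 * (c / y / ln 3) = 3 * c / ln 3 / y by field; rewrite !gt_eqF.
by rewrite ltr_pdivrMr // [e * y]mulrC -ltr_pdivrMr.
Qed.


(** * Upper bound for the defects below [s] *)

Definition defects_below (s : R) : set R := below defect_set s.

Definition positive_integers : set R := [set n%:R | n in [set n | (0 < n)%N]].

Lemma positive_integers_below N :
  below positive_integers N%:R `<=` finite_union N (fun i => [set i%:R]).
Proof. by move=> _ [[n _ <-] /=]; rewrite ltr_nat => nN; exists n. Qed.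

Lemma well_ordered_positive_integers : well_ordered positive_integers.
Proof.
apply/well_orderedP => A AP [a Aa].
have [n _ na] := AP _ Aa.
have ex : exists n : nat, `[< A n%:R >] by exists n; apply/asboolP; rewrite na.
have [m /asboolP Am mmin] := ex_minnP ex.
exists m%:R; split=> // x Ax; have [k _ kx] := AP _ Ax.
by rewrite -kx ler_nat; apply: mmin; apply/asboolP; rewrite kx.
Qed.

Lemma not_big_positive_integers : ~ big 2 positive_integers.
Proof.
apply: not_big_below => _ [n _ <-] /(big_sub (@positive_integers_below n)).
by apply: not_big_finite_union => i _; apply: not_big_set1.
Qed.

(* [S] is well-ordered of type less than [omega^k]. *)
Definition tame k (S : set R) := well_ordered S /\ ~ big k S.

Lemma tameU k A B : tame k A -> tame k B -> tame k (A `|` B).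
Proof.
by move=> [wA bA] [wB bB]; split; [apply: well_orderedU|apply: not_bigU].
Qed.

Lemma tame_sub k A B : A `<=` B -> tame k B -> tame k A.
Proof.
move=> AB [wB bB]; split; first exact: well_ordered_sub wB.
by move=> bA; apply: bB; apply: big_sub bA.
Qed.

Lemma tame_finite_union k n (A : nat -> set R) :
  (forall i, (i < n)%N -> tame k (A i)) -> tame k (finite_union n A).
Proof.
move=> tA; split.
  by apply: well_ordered_finite_union => i /tA[].
by apply: not_big_finite_union => i /tA[].
Qed.

Lemma tame_set0 k : tame k set0.
Proof. by split; [apply: well_ordered_set0|apply: not_big_set0]. Qed.

Lemma tame_set1 k (x : R) : (0 < k)%N -> tame k [set x].
Proof.
move=> k0; split; first exact: well_ordered_set1.
by move=> /(bigW k0); apply: not_big_set1.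
Qed.

Lemma tame_image2 (h : R -> R -> R) i j X Y :
  (forall x x' y y', X x -> X x' -> Y y -> Y y' ->
     x <= x' -> y <= y' -> h x y <= h x' y') ->
  tame i X -> tame j Y -> tame (i + j).-1 (image2 h X Y).
Proof.
move=> hmono [wX bX] [wY bY]; split; first exact: well_ordered_image2.
exact: not_big_image2.
Qed.

(** A grid of mesh [b] on the first defect covers the products by finitely many sumsets. Both bounds
    are capped at [s - gap], since the other defect is at least [gap], so the induction hypothesis
    applies. *)
Lemma tame_products (s : R) k :
  (forall s' k', s' <= s - gap -> s' < k'%:R -> tame k' (defects_below s')) ->
  s < k%:R ->
  tame k [set x | exists u v, [/\ (0 < u)%N, (0 < v)%N, gap <= defect u,
    gap <= defect v & x = defect u + defect v] /\ x < s].
Proof.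
move=> IH sk; pose b := (k%:R - s) / 2.
have b0 : 0 < b by rewrite divr_gt0 // subr_gt0.
have [s0|s0] := ltP s 0.
  apply: tame_sub (tame_set0 k) => x [u [v [[u0 v0 _ _ ->]]]] /=.
  by move: (defect_ge0 u0) (defect_ge0 v0); lra.
pose A i := image2 +%R (defects_below (Num.min (i.+1%:R * b) (s - gap)))
  (defects_below (Num.min (s - i%:R * b) (s - gap))).
apply: tame_sub (@tame_finite_union k (Num.truncn (s / b)).+1 A _).
  move=> x [u [v [[u0 v0 gu gv ->] ltx]]].
  have u0' := defect_ge0 u0; have v0' := defect_ge0 v0.
  exists (Num.truncn (defect u / b)).
    rewrite ltnS le_truncn // ler_pM2r ?invr_gt0 //; lra.
  have /andP[] := truncn_itv (divr_ge0 u0' (ltW b0)).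
  rewrite ler_pdivlMr // ltr_pdivrMr // => lei lti.
  have gt0 := gap_gt0.
  exists (defect u), (defect v); split=> //; split; try (by exists u); try (by exists v).
    by rewrite /= lt_min lti /=; lra.
  by rewrite /= lt_min; apply/andP; split; lra.
move=> i _.
have [si|is_] := leP (s - i%:R * b) 0.
  apply: tame_sub (tame_set0 k) => x [y [z [_ [[n n0 <-] /=]]]].
  by rewrite lt_min; have := defect_ge0 n0; lra.
(* The two bounds sum to at most [s + b < k], so the levels [k1] and [k + 1 - k1] exceed them;
   combining them gives level [k]. *)
set k1 := (Num.truncn (i.+1%:R * b)).+1.
have ib0 : 0 <= i.+1%:R * b by rewrite mulr_ge0 // ltW.
have lek1 : k1%:R <= i.+1%:R * b + 1.
  by rewrite /k1 -natr1 lerD2r truncn_le.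
have ibE : i.+1%:R * b = i%:R * b + b by rewrite -natr1 mulrDl mul1r.
have bE : 2 * b = k%:R - s by rewrite /b; field.
have k1k : (k1 <= k)%N.
  by rewrite -ltnS -(ltr_nat R) -[k.+1%:R]natr1; lra.
have -> : k = (k1 + (k.+1 - k1)).-1 by lia.
apply: tame_image2 => [? ? ? ? _ _ _ _||]; first exact: lerD.
  by apply: IH; rewrite ?ge_min ?gt_min ?lexx ?orbT // truncnS_gt.
apply: IH; rewrite ?ge_min ?lexx ?orbT // gt_min; apply/orP; left.
by rewrite natrB ?(leqW k1k) // -natr1; lra.
Qed.

Lemma tame_sums (s : R) k :
  (forall s' k', s' <= s - gap -> s' < k'%:R -> tame k' (defects_below s')) ->
  s < k.+1%:R ->
  tame k.+1 [set x | exists a b, [/\ (0 < b)%N, (b <= a)%N &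
    x = defect a + (complexity b)%:R - 3 * log3 (1 + b%:R / a%:R)] /\ x < s].
Proof.
move=> IH sk.
(* As [b <= a], the correction is at most [3 log3 2 <= 2], so [complexity b < M]; [cube_gap] then
   bounds [b] by [3 ^ M]. *)
pose M := (Num.truncn (s + 2)).+1.
pose V b := [set x | exists a, [/\ (0 < b)%N, (b <= a)%N &
    x = defect a + (complexity b)%:R - 3 * log3 (1 + b%:R / a%:R)] /\ x < s].
apply: tame_sub (@tame_finite_union k.+1 (3 ^ M).+1 V _).
  move=> x [a [b [[b0 ba xE] xs]]]; exists b; last by exists a.
  have a0 : (0 < a)%N := leq_trans b0 ba.
  have l2 : 3 * log3 (1 + b%:R / a%:R) <= 2.
    apply: le_trans (_ : 3%:R * log3 2 <= _).
      rewrite ler_pM2l // ler_log3 //; first by rewrite ltr_wpDr // divr_ge0.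
      have : (b%:R / a%:R : R) <= 1 by rewrite ler_pdivrMr ?ltr0n // mul1r ler_nat.
      lra.
    rewrite -log3X // -[leRHS]log3_3X; apply: ler_log3; first by rewrite exprn_gt0.
    by rewrite -!natrX ler_nat.
  have cM : (complexity b < M)%N.
    rewrite -(ltr_nat R) /M; apply: lt_trans (truncnS_gt _).
    by have := defect_ge0 a0; lra.
  rewrite ltnS; apply: leq_trans (_ : b ^ 3 <= _)%N.
    by rewrite -{1}[b]expn1 leq_pexp2l.
  have [e [ve oe]] := complexityW b0.
  apply: leq_trans (_ : 3 ^ complexity b <= _)%N; last by rewrite leq_pexp2l // ltnW.
  by rewrite -oe -ve; have := cube_gap e; lia.
move=> b _; have [b0|b0] := posnP b.
  by apply: tame_sub (tame_set0 _) => x [a []]; rewrite b0 => -[].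
(* The first bound on [e] gives [s - 1 + e <= s - gap], the second gives [s - 1 + e < k]. *)
pose e := Num.min 2^-1 ((k.+1%:R - s) / 2).
have e0 : 0 < e by rewrite lt_min; apply/andP; split; lra.
have [N NP] := three_log3_lt (ler0n R b) e0.
(* The defect of [a] and [a] itself become independent variables. The integers are not big of level
   2, so they raise the level from [k] to [k + 1] only. *)
pose h (x y : R) := x + (complexity b)%:R - 3 * log3 (1 + b%:R / y).
pose X := defects_below (s - 1 + e).
have subV : V b `<=` finite_union N
    (fun a => [set h (defect a) a%:R]) `|` image2 h X positive_integers.
  move=> x [a [[_ ba xE] xs]]; case: (ltnP a N) => aN.
    by left; exists a.
  have [|a0 lt] := NP a%:R; first by rewrite ler_nat.
  rewrite ltr0n in a0; right; exists (defect a), a%:R; split=> //; last by exists a.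
  split; first by exists a.
  have : (1 : R) <= (complexity b)%:R.
    rewrite ler1n; have [f [_ <-]] := complexityW b0.
    by elim: f => //= ? ? ? ?; rewrite ltn_addr.
  by rewrite /= xE in xs *; lra.
apply: (tame_sub subV); apply: tameU.
  by apply: tame_finite_union => i _; apply: tame_set1.
have -> : k.+1 = (k + 2).-1 by rewrite addn2.
apply: tame_image2.
- move=> x x' _ _ _ _ [y y0 <-] [y' y'0 <-] xx' yy'.
  rewrite /h; suff : log3 (1 + b%:R / y'%:R) <= log3 (1 + b%:R / y%:R) by lra.
  apply: ler_log3; first by rewrite ltr_wpDr // divr_ge0.
  by rewrite lerD2l ler_pM2l ?ltr0n // lef_pV2 // posrE ltr0n.
- have : e <= 2^-1 by rewrite ge_min lexx.
  have : e <= (k.+1%:R - s) / 2 by rewrite ge_min lexx orbT.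
  have kE : k.+1%:R = k%:R + 1 :> R by rewrite natr1.
  by move=> ek eh; apply: IH; have := gap_le_half; lra.
- by split; [apply: well_ordered_positive_integers|apply: not_big_positive_integers].
Qed.

(** Induction on [n] with [s < n * gap]. Apart from products and sums only the defects 0 and 1
    occur; for [k = 0] no defect lies below [s]. *)
Lemma tame_defects_below (s : R) k : s < k%:R -> tame k (defects_below s).
Proof.
have g0 := gap_gt0.
have [n] : exists n : nat, s < n%:R * gap.
  exists (Num.truncn (s / gap)).+1; rewrite -ltr_pdivrMr //; exact: truncnS_gt.
elim: n s k => [|n IH] s k lts sk.
  apply: tame_sub (tame_set0 k) => x [[m m0 <-] /= dm].
  by move: (defect_ge0 m0); lra.
have {}IH s' k' : s' <= s - gap -> s' < k'%:R -> tame k' (defects_below s').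
  by move=> s's; apply: IH; rewrite -natr1 in lts; lra.
case: k sk => [|k] sk.
  apply: tame_sub (tame_set0 0) => x [[m m0 <-] /= dm].
  by move: (defect_ge0 m0); lra.
apply: tame_sub (tameU (tameU (tame_set1 0 _) (tame_set1 1 _))
  (tameU (tame_products IH sk) (tame_sums IH sk))) => // x [[n' n0 <-] ltx].
have [->|->|[u [v uv]]|[a [b ab]]] := defect_cases n0.
- by left; left.
- by left; right.
- by right; left; exists u, v.
- by right; right; exists a, b.
Qed.

(** * Lower bound by towers over powers of 3 *)

(* Pairs (value, cost) for the expressions [(..(3^j1 + 1) 3^j2 + ..) 3^jk + 1],
   with exponents [j.+1 > 0] since [3 ^ 0] would not cost [3 * 0] ones. *)
Fixpoint towers (k : nat) : set (nat * nat) :=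
  if k is k'.+1 then
    [set p | exists q j, towers k' q /\ p = (q.1 * 3 ^ j.+1 + 1, q.2 + 3 * j.+1 + 1)%N]
  else [set (1, 0)%N].

Definition cost_defect (p : nat * nat) : R := p.2%:R - 3 * log3 p.1%:R.

(** The empty tower [(1, 0)] is not writable by itself, but becomes so after multiplication by a
    positive power of 3; this makes the induction start. *)
Lemma towers_writable k p j : towers k p ->
  writable (p.1 * 3 ^ j.+1) (p.2 + 3 * j.+1).
Proof.
elim: k p j => [|k IH] p j /=.
  by move->; rewrite mul1n add0n; apply: writable3X.
case=> q [i [/IH tq ->]] /=; apply: writableM; last exact: writable3X.
by apply: writableD writable1; apply: tq.
Qed.

Lemma towers_gt0 k p : towers k p -> (0 < p.1)%N.
Proof. by move/(@towers_writable _ _ 0)/writable_gt0; rewrite muln_gt0 => /andP[]. Qed.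

Lemma cost_defect_tower k p j : towers k p ->
  cost_defect (p.1 * 3 ^ j.+1 + 1, p.2 + 3 * j.+1 + 1)%N =
  cost_defect p + 1 - 3 * log3 (1 + 1 / (p.1 * 3 ^ j.+1)%:R).
Proof.
move/towers_gt0 => p0; rewrite /cost_defect /=.
set x : R := (p.1 * 3 ^ j.+1)%:R.
have x0 : 0 < x by rewrite ltr0n muln_gt0 p0 expn_gt0.
have xE : log3 x = log3 p.1%:R + j.+1%:R.
  by rewrite /x natrM natrX log3M ?log3_3X ?ltr0n ?exprn_gt0.
have -> : (p.1 * 3 ^ j.+1 + 1)%:R = x * (1 + 1 / x).
  by rewrite natrD -/x mulrDr mulr1 mul1r divff // gt_eqF.
rewrite log3M // ?xE; last by rewrite ltr_wpDr // divr_ge0 // ltW.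
by rewrite !natrD natrM; ring.
Qed.

Lemma cost_defect_lt k p : towers k.+1 p -> cost_defect p < k.+1%:R.
Proof.
have step q j l : towers l q -> cost_defect q <= l%:R ->
    cost_defect (q.1 * 3 ^ j.+1 + 1, q.2 + 3 * j.+1 + 1)%N < l.+1%:R.
  move=> tq le; rewrite (cost_defect_tower _ tq) -natr1.
  suff : 0 < log3 (1 + 1 / (q.1 * 3 ^ j.+1)%:R) by lra.
  rewrite -log3_1; apply: ltr_log3 => //.
  by rewrite ltrDl divr_gt0 // ltr0n muln_gt0 (towers_gt0 tq) expn_gt0.
elim: k p => [|k IH] p [q [j [tq ->]]].
  by apply: (step q j 0%N tq); move: tq => ->; rewrite /cost_defect /= log3_1 mulr0 subr0.
exact: (step q j k.+1 tq (ltW (IH _ tq))).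
Qed.

(** Extending a tower [p] with growing exponents gives nominal defects increasing to
    [cost_defect p + 1], so [big_approached] applies with translation 1. *)
Lemma big_towers k : big k [set cost_defect p | p in towers k].
Proof.
elim: k => [|k IH]; first by exists (cost_defect (1, 0)%N), (1, 0)%N.
apply: (big_approached (t := 1) IH) => _ y [p tp <-] yp.
pose v j := cost_defect (p.1 * 3 ^ j.+1 + 1, p.2 + 3 * j.+1 + 1)%N.
have p0 := towers_gt0 tp.
have q0 j : 0 < (p.1 * 3 ^ j.+1)%:R :> R by rewrite ltr0n muln_gt0 p0 expn_gt0.
have ltv j : v j < cost_defect p + 1.
  rewrite /v (cost_defect_tower _ tp) ltrBlDr ltrDl mulr_gt0 // -log3_1.
  by apply: ltr_log3 => //; rewrite ltrDl divr_gt0.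
have vlt i j : (i < j)%N -> v i < v j.
  move=> ij; rewrite /v !(cost_defect_tower _ tp) ltrD2l ltrN2 ltr_pM2l //.
  apply: ltr_log3; first by rewrite ltr_wpDr // divr_ge0 // ltW.
  by rewrite ltrD2l ltr_pM2l // ltf_pV2 ?posrE // ltr_nat ltn_pmul2l // ltn_exp2l.
have [N NP] : exists N, forall j, (N <= j)%N -> y <= v j.
  have [|N NP] := @three_log3_lt 1 (cost_defect p + 1 - y) ler01.
    by rewrite subr_gt0.
  exists N => j Nj; have [|_] := NP (p.1 * 3 ^ j.+1)%:R.
    rewrite ler_nat (leq_trans Nj) // (leq_trans _ (leq_pmull _ p0)) //.
    by rewrite (leq_trans (ltnW (ltn_expl j (isT : 1 < 3)%N))) // leq_exp2l.
  by rewrite /v (cost_defect_tower _ tp); lra.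
exists (fun i => [set v (N + i)%N]); split=> [i _ ->|i|i j _ _ ij -> ->].
- split.
    exists (p.1 * 3 ^ (N + i).+1 + 1, p.2 + 3 * (N + i).+1 + 1)%N => //.
    by exists p, (N + i)%N.
  by rewrite /= ltv NP // leq_addr.
- by exists (v (N + i)%N).
- by apply: vlt; rewrite ltn_add2l.
Qed.

Lemma big_defects_below k : (0 < k)%N -> big k (defects_below k%:R).
Proof.
case: k => // k _; apply: contrapT => nb.
(* [t] is the excess of the nominal cost over the complexity. For [t > 0] the true defect is below
   [k], hence that piece is not big of level [k + 1]. *)
pose A t := if t is t'.+1 then image2 +%R (defects_below k%:R) [set t'.+1%:R]
  else defects_below k.+1%:R.
have [] : ~ big k.+1 (finite_union k.+2 A); last first.
  apply: big_sub (big_towers k.+1) => _ [p tp <-].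
  have lt := cost_defect_lt tp.
  have p0 := towers_gt0 tp.
  have wp : writable p.1 p.2.
    by case: tp => q [j [tq ->]]; apply: writableD writable1; apply: towers_writable tq.
  have [t pt] : exists t, p.2 = (complexity p.1 + t)%N.
    by exists (p.2 - complexity p.1)%N; have := complexity_min wp; lia.
  have dE : cost_defect p = defect p.1 + t%:R.
    by rewrite /cost_defect /Defs.defect pt natrD; ring.
  have d0 := defect_ge0 p0.
  exists t; first by rewrite -(ltr_nat R) -natr1; lra.
  case: t {pt} dE => [|t] dE /=.
    by rewrite dE addr0 in lt *; split=> //; exists p.1.
  exists (defect p.1), t.+1%:R; split=> //; split; first by exists p.1.
  by rewrite -!natr1 in lt dE *; rewrite /=; have := ler0n R t; lra.
apply: not_big_finite_union => -[|t] _ //.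
have tk : tame k.+1 (defects_below k%:R) by apply: tame_defects_below; rewrite ltr_nat.
have [|_] := tame_image2 (h := +%R) _ tk (@tame_set1 1 t.+1%:R (ltnSn 0)).
  by move=> ? ? ? ? _ _ _ _; apply: lerD.
by rewrite addn1.
Qed.

(** An integral defect makes [n ^ 3], hence [n], a power of 3: either [n = 1], of defect 1, or the
    defect is 0. *)
Lemma defect_nat n k : (0 < n)%N -> defect n = k%:R -> (k <= 1)%N.
Proof.
move=> n0 dn.
have : 3 * log3 n%:R = (complexity n)%:R - k%:R :> R by rewrite -dn /Defs.defect; ring.
rewrite log3_cube // => ln3E.
have kc : (k <= complexity n)%N.
  rewrite -(ler_nat R) -subr_ge0 -ln3E -log3_1; apply: ler_log3 => //.
  by rewrite ler1n expn_gt0 n0.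
rewrite -natrB // -[RHS]log3_3X -natrX in ln3E.
have n3 : (n ^ 3 = 3 ^ (complexity n - k))%N.
  apply/eqP; rewrite -(eqr_nat R); apply/eqP; apply: log3_inj => //;
    by rewrite ltr0n expn_gt0 ?n0.
have : (n %| 3 ^ (complexity n - k))%N by rewrite -n3 expnS dvdn_mulr.
case/(dvdn_pfactor _ _ (isT : prime 3)) => -[|i] _ nE.
  by move: dn; rewrite nE defect1 => /eqP; rewrite -[1]/(1%:R) eqr_nat => /eqP <-.
have : defect n <= 0.
  rewrite /Defs.defect subr_le0 nE natrX log3_3X -natrM ler_nat.
  by apply: complexity_min; apply: writable3X.
by rewrite dn lern0 => /eqP ->.
Qed.

End Defects.

(** * Order types of the closed initial segments *)

Theorem theorem6p6 (R : realType) :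
  (forall k : nat, k <> 1%N ->
     well_ordered (@defect_set R `&` `[0, k%:R]) /\
     has_order_type (@defect_set R `&` `[0, k%:R]) (oexp oomega k)) /\
  (well_ordered (@defect_set R `&` `[0, 1]) /\
   has_order_type (@defect_set R `&` `[0, 1]) (oadd oomega oone)).
Proof.
have D0 (x : R) : defect_set x -> 0 <= x by case=> n n0 <-; apply: defect_ge0.
have woD k : well_ordered (@defect_set R `&` `[0, k%:R]).
  apply: (@well_ordered_sub R _ (defects_below k.+1%:R)) => [x [Dx]|]; last first.
    by have [] := @tame_defects_below R k.+1%:R k.+2; rewrite ?ltr_nat.
  rewrite /= in_itv /= => /andP[_ xk]; split=> //=.
  by apply: le_lt_trans xk _; rewrite ltr_nat.
have small k x : x < k%:R -> ~ big k (@defects_below R x).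
  by case/tame_defects_below.
split=> [k k1|].
  split; first exact: woD.
  apply: has_order_type_omega_pow; first exact: woD.
    case: k k1 => [|k] k1.
      exists 0; split; last by rewrite /= in_itv /= lexx.
      exists 3 => //; apply/le_anti; rewrite defect_ge0 // andbT.
      rewrite /defect log3_3 mulr1 subr_le0 ler_nat.
      by have := complexity_min (writable3X (ltnSn 0)).
    apply: big_sub (@big_defects_below R k.+1 isT) => x [Dx /= xk].
    by split=> //; rewrite /= in_itv /= D0 //= ltW.
  move=> x [Dx]; rewrite /= in_itv /= => /andP[x0 xk] bx.
  have {bx} : big k (defects_below x) by apply: big_sub bx => y [[Dy _] yx].
  case: k k1 xk => [|k] k1 xk; first by case=> y [/D0 y0 /= yx]; lra.
  (* For [k >= 2] the endpoint [k] is not a defect, so [x < k] strictly. *)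
  apply: small; rewrite lt_neqAle xk andbT; apply/eqP => xE.
  by have [n n0 dn] := Dx; have := defect_nat n0 (etrans dn xE); case: k k1 {xk xE}.
split; first exact: (woD 1%N).
have [f [[fD finj fsurj] fmono]] : has_order_type (@defects_below R 1) (oexp oomega 1).
  apply: has_order_type_omega_pow.
  - by have [] := @tame_defects_below R 1 2; rewrite ?ltr1n.
  - exact: (@big_defects_below R 1 isT).
  move=> x [Dx x1] bx; apply: (small 1%N x) => //.
  by apply: big_sub bx => y [[Dy _] yx].
(* The defects below 1 form the copy of omega; the defect 1 of the number 1 is the added top
   element. *)
exists (fun c : nat + unit => if c is inl i then f (i, tt) else 1); split.
  split.
  - move=> [i|[]] _ /=; rewrite in_itv /=.
      by have [Df /= f1] := fD (i, tt) I; split=> //; rewrite D0 // ltW.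
    by rewrite ler01 lexx; split=> //; exists 1 => //; rewrite defect1.
  - move=> [i|[]] [j|[]] _ _ //= fij.
    + by have [->] := finj (i, tt) (j, tt) (mem_set I) (mem_set I) fij.
    + by have [_ /=] := fD (i, tt) I; rewrite fij ltxx.
    + by have [_ /=] := fD (j, tt) I; rewrite -fij ltxx.
  - move=> x [Dx]; rewrite /= in_itv /= => /andP[_].
    rewrite le_eqVlt => /predU1P[->|x1]; first by exists (inr tt).
    by have [[i []] _ <-] := fsurj x (conj Dx x1); exists (inl i).
have fltE i j : (i < j)%N <-> f (i, tt) < f (j, tt).
  rewrite -fmono; split=> [ij|]; first exact: left_slex.
  by move=> ij; inversion ij.
move=> [i|[]] [j|[]] /=; split.
- by move=> ij; apply/fltE; inversion ij.
- by move/fltE => ij; apply: le_aa.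
- by move=> _; have [_] := fD (i, tt) I.
- by move=> _; apply: le_ab.
- by move=> ij; inversion ij.
- by have [_ /=] := fD (j, tt) I => f1 /(lt_trans f1); rewrite ltxx.
- by move=> ij; inversion ij.
- by rewrite ltxx.
Qed.
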